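(* Let $\Bbbk$ be an algebraically closed field of characteristic zero, let $H$ be an affine Hopf algebra over $\Bbbk$ with antipode $S$ and let $C$ be a central Hopf subalgebra of $H$ such that $H$ is a finitely generated $C$-module. If $H$ is involutory, that is, $S^2=\mathrm{id}$, then $H$ has the Chevalley property.
   Context: Affine means finitely generated as an algebra. A Hopf algebra $H$ has the Chevalley property if the tensor product of any two finite-dimensional irreducible $H$-modules is a completely reducible $H$-module. *)

(* Defs.v *)
From HB Require Import structures.
From mathcomp Require Import all_boot all_algebra.
From mathcomp Require Import boolp.

Set Implicit Arguments.
Unset Strict Implicit.
Unset Printing Implicit Defensive.

Import GRing.Theory.
Local Open Scope ring_scope.
Local Open Scope quotient_scope.

Notation is_bilinear f := (bilinear_for *:%R *:%R f).

Section TensorType.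
Variables (R : comNzRingType) (U V : lmodType R).

(* A formal sum of pure tensors is a sequence of pairs; two of them are        *)
(* identified when no bilinear map distinguishes them. The universal property  *)
(* of the quotient is proved below (tlift_is_linear, tlift_tens, tlift_uniq).  *)
Definition tens_eq (s t : seq (U * V)) : Prop :=
  forall (W : lmodType R) (f : U -> V -> W), is_bilinear f ->
    \sum_(p <- s) f p.1 p.2 = \sum_(p <- t) f p.1 p.2.

Definition tens_rel (s t : seq (U * V)) : bool := `[< tens_eq s t >].

Lemma tens_rel_refl : reflexive tens_rel.
Proof. by move=> s; apply/asboolP. Qed.

Lemma tens_rel_sym : symmetric tens_rel.
Proof.
by move=> s t; apply/asboolP/asboolP=> st W f fB; rewrite (st W f fB).
Qed.

Lemma tens_rel_trans : transitive tens_rel.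
Proof.
move=> t s u /asboolP st /asboolP tu; apply/asboolP=> W f fB.
by rewrite (st W f fB) (tu W f fB).
Qed.

Canonical tens_equiv := EquivRel tens_rel tens_rel_refl tens_rel_sym tens_rel_trans.

Definition tensor := {eq_quot tens_equiv}.

HB.instance Definition _ := Choice.on tensor.
HB.instance Definition _ := Quotient.on tensor.

Definition tens (u : U) (v : V) : tensor := \pi_tensor [:: (u, v)].

(* Meaningful when f is bilinear: the linear map u (x) v |-> f u v. *)
Definition tlift (W : lmodType R) (f : U -> V -> W) (t : tensor) : W :=
  \sum_(p <- repr t) f p.1 p.2.

Lemma tens_pi_eq (s t : seq (U * V)) :
  \pi_tensor s = \pi_tensor t <-> tens_eq s t.
Proof.
split; first by move=> /eqP; rewrite eqmodE => /asboolP.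
by move=> st; apply/eqP; rewrite eqmodE; apply/asboolP.
Qed.

Lemma tlift_pi (W : lmodType R) (f : U -> V -> W) (s : seq (U * V)) :
  is_bilinear f -> tlift f (\pi_tensor s) = \sum_(p <- s) f p.1 p.2.
Proof. by move=> fB; apply: (proj1 (tens_pi_eq _ _) _ W f fB); rewrite reprK. Qed.

Lemma tensor_ext (t t' : tensor) :
  (forall (W : lmodType R) (f : U -> V -> W), is_bilinear f ->
     tlift f t = tlift f t') -> t = t'.
Proof. by move=> tt'; rewrite -[t]reprK -[t']reprK; apply/tens_pi_eq. Qed.

Definition tens0 : tensor := \pi_tensor [::].
Definition tens_add (t t' : tensor) : tensor := \pi_tensor (repr t ++ repr t').
Definition tens_scale (a : R) (t : tensor) : tensor :=
  \pi_tensor [seq (a *: p.1, p.2) | p <- repr t].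
Definition tens_opp (t : tensor) : tensor := tens_scale (- 1) t.

Lemma tlift0 (W : lmodType R) (f : U -> V -> W) : is_bilinear f -> tlift f tens0 = 0.
Proof. by move=> fB; rewrite tlift_pi // big_nil. Qed.

Lemma tlift_add (W : lmodType R) (f : U -> V -> W) t t' : is_bilinear f ->
  tlift f (tens_add t t') = tlift f t + tlift f t'.
Proof. by move=> fB; rewrite tlift_pi // big_cat. Qed.

Lemma tlift_scale (W : lmodType R) (f : U -> V -> W) a t : is_bilinear f ->
  tlift f (tens_scale a t) = a *: tlift f t.
Proof.
move=> fB; rewrite tlift_pi // big_map /tlift scaler_sumr.
by apply: eq_bigr => p _ /=; rewrite (scalable_linear (fB.1 _)).
Qed.

Lemma tens_addA : associative tens_add.
Proof. by move=> x y z; apply: tensor_ext => W f fB; rewrite !tlift_add // addrA. Qed.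

Lemma tens_addC : commutative tens_add.
Proof. by move=> x y; apply: tensor_ext => W f fB; rewrite !tlift_add // addrC. Qed.

Lemma tens_add0 : left_id tens0 tens_add.
Proof. by move=> x; apply: tensor_ext => W f fB; rewrite tlift_add // tlift0 // add0r. Qed.

Lemma tens_addN : left_inverse tens0 tens_opp tens_add.
Proof.
move=> x; apply: tensor_ext => W f fB.
by rewrite tlift_add // tlift_scale // tlift0 // scaleN1r addNr.
Qed.

HB.instance Definition _ :=
  GRing.isZmodule.Build tensor tens_addA tens_addC tens_add0 tens_addN.

Lemma tens_scaleA a b t : tens_scale a (tens_scale b t) = tens_scale (a * b) t.
Proof. by apply: tensor_ext => W f fB; rewrite !tlift_scale // scalerA. Qed.

Lemma tens_scale1 : left_id 1 tens_scale.
Proof. by move=> t; apply: tensor_ext => W f fB; rewrite tlift_scale // scale1r. Qed.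

Lemma tens_scaleDr : right_distributive tens_scale +%R.
Proof.
move=> a t t'; apply: tensor_ext => W f fB.
by rewrite tlift_scale // !tlift_add // !tlift_scale // scalerDr.
Qed.

Lemma tens_scaleDl t : {morph tens_scale^~ t : a b / a + b}.
Proof.
move=> a b; apply: tensor_ext => W f fB.
by rewrite tlift_add // !tlift_scale // scalerDl.
Qed.

HB.instance Definition _ := GRing.Zmodule_isLmodule.Build R tensor
  tens_scaleA tens_scale1 tens_scaleDr tens_scaleDl.

End TensorType.

Notation "U ⊗ V" := (tensor U%type V%type) (at level 39, left associativity) : type_scope.
Notation "u ⊗ v" := (tens u v) (at level 39, left associativity) : ring_scope.

Section TensorTheory.
Variable R : comNzRingType.
Implicit Types U V W : lmodType R.

Lemma tlift_is_linear U V W (f : U -> V -> W) : is_bilinear f -> linear (tlift f).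
Proof. by move=> fB a t t'; rewrite tlift_add // tlift_scale. Qed.

Lemma tlift_tens U V W (f : U -> V -> W) u v : is_bilinear f -> tlift f (u ⊗ v) = f u v.
Proof. by move=> fB; rewrite tlift_pi // big_seq1. Qed.

Lemma tens_bilinear U V : is_bilinear (@tens R U V).
Proof.
split=> [v a u u'|u a v v'] /=; apply: tensor_ext => W f fB.
  by rewrite (tlift_is_linear fB) !tlift_tens // fB.1.
by rewrite (tlift_is_linear fB) !tlift_tens // fB.2.
Qed.

Arguments tens_bilinear {U V}.

Lemma tensor_ind U V (P : U ⊗ V -> Prop) :
  P 0 -> (forall u v t, P t -> P (u ⊗ v + t)) -> forall t, P t.
Proof.
move=> P0 PD t; rewrite -[t]reprK; elim: (repr t) => [//|[u v] s IHs].
suff -> : \pi_(tensor U V) ((u, v) :: s) = u ⊗ v + \pi_(tensor U V) s by apply: PD.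
apply: tensor_ext => W f fB; rewrite tlift_add // !tlift_pi // big_cons /=.
by rewrite big_seq1.
Qed.

Lemma tlift_uniq U V W (f : U -> V -> W) (g : U ⊗ V -> W) :
  is_bilinear f -> linear g -> (forall u v, g (u ⊗ v) = f u v) -> g =1 tlift f.
Proof.
move=> fB gL gE; have fL := tlift_is_linear fB.
elim/tensor_ind=> [|u v t IHt].
  have := gL (-1) 0 0; rewrite scaleN1r addNr => ->.
  by rewrite scaleN1r addNr tlift0.
by rewrite -[u ⊗ v]scale1r gL fL gE tlift_tens // IHt.
Qed.

Lemma eq_linear_tens U V W (f g : U ⊗ V -> W) : linear f -> linear g ->
  (forall u v, f (u ⊗ v) = g (u ⊗ v)) -> f =1 g.
Proof.
move=> fL gL fg t.
have B : is_bilinear (fun u v => g (u ⊗ v)).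
  split=> [v a u u'|u a v v'] /=.
    by rewrite tens_bilinear.1 gL.
  by rewrite tens_bilinear.2 gL.
by rewrite (tlift_uniq B fL fg) (tlift_uniq B gL).
Qed.

Definition tmap U V U' V' (f : U -> U') (g : V -> V') : U ⊗ V -> U' ⊗ V' :=
  tlift (fun u v => f u ⊗ g v).

Definition tassoc U V W : (U ⊗ V) ⊗ W -> U ⊗ (V ⊗ W) :=
  tlift (fun t w => tlift (fun u v => u ⊗ (v ⊗ w)) t).

Lemma tmap_bilinear U V U' V' (f : U -> U') (g : V -> V') :
  linear f -> linear g -> is_bilinear (fun u v => f u ⊗ g v).
Proof.
move=> fL gL; split=> [v a u u'|u a v v'] /=.
  by rewrite fL tens_bilinear.1.
by rewrite gL tens_bilinear.2.
Qed.

Lemma tmap_is_linear U V U' V' (f : U -> U') (g : V -> V') :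
  linear f -> linear g -> linear (tmap f g).
Proof. by move=> fL gL; apply/tlift_is_linear/tmap_bilinear. Qed.

Lemma tmap_tens U V U' V' (f : U -> U') (g : V -> V') u v :
  linear f -> linear g -> tmap f g (u ⊗ v) = f u ⊗ g v.
Proof. by move=> fL gL; rewrite /tmap tlift_tens //; apply: tmap_bilinear. Qed.


(* In tlift2 F s t, F is meant to be multilinear in its four arguments. *)
Definition tlift2 U V U' V' W (F : U -> V -> U' -> V' -> W)
  (s : U ⊗ V) (t : U' ⊗ V') : W := tlift (fun u v => tlift (F u v) t) s.

Section Tlift2.
Variables (U V U' V' W : lmodType R) (F : U -> V -> U' -> V' -> W).
Hypothesis F12 : forall u' v', is_bilinear (fun u v => F u v u' v').
Hypothesis F34 : forall u v, is_bilinear (F u v).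

Let inner_bilinear t : is_bilinear (fun u v => tlift (F u v) t).
Proof.
split=> [v a u u'|u a v v'] /=; rewrite /tlift scaler_sumr -big_split /=;
  apply: eq_bigr => p _.
  exact: ((F12 p.1 p.2).1 v a u u').
exact: ((F12 p.1 p.2).2 u a v v').
Qed.

Lemma tlift2_bilinear : is_bilinear (tlift2 F).
Proof.
split=> [t a s s'|s a t t'] /=.
  exact: (tlift_is_linear (inner_bilinear t)).
rewrite /tlift2 /tlift scaler_sumr -big_split /=; apply: eq_bigr => p _.
exact: (tlift_is_linear (F34 p.1 p.2)).
Qed.

Lemma tlift2_tens u v u' v' : tlift2 F (u ⊗ v) (u' ⊗ v') = F u v u' v'.
Proof. by rewrite /tlift2 tlift_tens // tlift_tens. Qed.

End Tlift2.
Lemma tassoc_bilinear U V W : is_bilinear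
  (fun (t : U ⊗ V) (w : W) => tlift (fun u v => u ⊗ (v ⊗ w)) t).
Proof.
have B w : is_bilinear (fun u v => (u : U) ⊗ ((v : V) ⊗ (w : W))).
  split=> [v a u u'|u a v v'] /=; first by rewrite tens_bilinear.1.
  by rewrite tens_bilinear.1 tens_bilinear.2.
split=> [w|t a w w'] /=; first exact: tlift_is_linear (B w).
rewrite /tlift scaler_sumr -big_split /=; apply: eq_bigr => p _.
by rewrite tens_bilinear.2 tens_bilinear.2.
Qed.

Lemma tassoc_tens U V W (u : U) (v : V) (w : W) :
  tassoc ((u ⊗ v) ⊗ w) = u ⊗ (v ⊗ w).
Proof.
rewrite /tassoc tlift_tens; last exact: tassoc_bilinear.
rewrite tlift_tens //; split=> [v' a x x'|x a v' v''] /=.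
  by rewrite tens_bilinear.1.
by rewrite tens_bilinear.1 tens_bilinear.2.
Qed.

End TensorTheory.

Arguments tens_bilinear {R U V}.

Section TensorAlgebra.
Variables (R : comNzRingType) (A B : algType R).

Definition tens_one : A ⊗ B := 1 ⊗ 1.

(* (a (x) b) (c (x) d) = ac (x) bd *)
Definition tens_mul : A ⊗ B -> A ⊗ B -> A ⊗ B :=
  tlift2 (fun a b c d => (a * c) ⊗ (b * d)).

Let mul12 (c : A) (d : B) : is_bilinear (fun a b => (a * c) ⊗ (b * d)).
Proof.
split=> [b k a a'|a k b b'] /=; rewrite mulrDl -scalerAl.
  by rewrite tens_bilinear.1.
by rewrite tens_bilinear.2.
Qed.

Let mul34 (a : A) (b : B) : is_bilinear (fun c d => (a * c) ⊗ (b * d)).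
Proof.
split=> [d k c c'|c k d d'] /=; rewrite mulrDr -scalerAr.
  by rewrite tens_bilinear.1.
by rewrite tens_bilinear.2.
Qed.

Lemma tens_mul_bilinear : is_bilinear tens_mul.
Proof. exact: tlift2_bilinear mul12 mul34. Qed.

Lemma tens_mul_tens a b c d : tens_mul (a ⊗ b) (c ⊗ d) = (a * c) ⊗ (b * d).
Proof. exact: tlift2_tens mul12 mul34 _ _ _ _. Qed.

Lemma tens_mulDl : left_distributive tens_mul +%R.
Proof.
by move=> x y z; have := tens_mul_bilinear.1 z 1 x y; rewrite /= !scale1r.
Qed.

Lemma tens_mulDr : right_distributive tens_mul +%R.
Proof.
by move=> x y z; have := tens_mul_bilinear.2 x 1 y z; rewrite /= !scale1r.
Qed.

Lemma tens_mul0l x : tens_mul 0 x = 0.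
Proof. by apply: (addrI (tens_mul 0 x)); rewrite -tens_mulDl !addr0. Qed.

Lemma tens_mul0r x : tens_mul x 0 = 0.
Proof. by apply: (addrI (tens_mul x 0)); rewrite -tens_mulDr !addr0. Qed.

Lemma tens_mul1l : left_id tens_one tens_mul.
Proof.
elim/tensor_ind=> [|a b t IHt]; first exact: tens_mul0r.
by rewrite tens_mulDr IHt tens_mul_tens !mul1r.
Qed.

Lemma tens_mul1r : right_id tens_one tens_mul.
Proof.
elim/tensor_ind=> [|a b t IHt]; first exact: tens_mul0l.
by rewrite tens_mulDl IHt tens_mul_tens !mulr1.
Qed.

Lemma tens_mulA : associative tens_mul.
Proof.
elim/tensor_ind=> [|a b x IHx] y z; first by rewrite !tens_mul0l.
rewrite !tens_mulDl IHx; congr (_ + _) => {x IHx}.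
elim/tensor_ind: y z => [|c d y IHy] z.
  by rewrite tens_mul0r !tens_mul0l tens_mul0r.
rewrite tens_mulDl !tens_mulDr tens_mulDl IHy; congr (_ + _) => {y IHy}.
elim/tensor_ind: z => [|e f z IHz]; first by rewrite !tens_mul0r.
by rewrite !tens_mulDr IHz !tens_mul_tens !mulrA.
Qed.

HB.instance Definition _ := GRing.Zmodule_isPzRing.Build (tensor A B)
  tens_mulA tens_mul1l tens_mul1r tens_mulDl tens_mulDr.

Lemma tensM (a c : A) (b d : B) : (a ⊗ b) * (c ⊗ d) = (a * c) ⊗ (b * d).
Proof. exact: tens_mul_tens. Qed.

End TensorAlgebra.

HB.mixin Record isHopf (K : fieldType) H of GRing.Algebra K H := {
  comul : H -> H ⊗ H;
  counit : H -> K;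
  antipode : H -> H;
  comul_is_linear : linear comul;
  comul_is_monoid_morphism : monoid_morphism comul;
  counit_is_scalar : scalar counit;
  counit_is_monoid_morphism : monoid_morphism counit;
  antipode_is_linear : linear antipode;
  comulA : forall x : H,
    tassoc (tmap comul idfun (comul x)) = tmap idfun comul (comul x);
  comul_counitl : forall x : H,
    tlift (fun a b : H => counit a *: b) (comul x) = x;
  comul_counitr : forall x : H,
    tlift (fun a b : H => counit b *: a) (comul x) = x;
  antipodel : forall x : H,
    tlift (fun a b : H => antipode a * b) (comul x) = (counit x)%:A;
  antipoder : forall x : H,
    tlift (fun a b : H => a * antipode b) (comul x) = (counit x)%:A
}.

#[short(type="hopfAlgType")]
HB.structure Definition HopfAlgebra (K : fieldType) :=
  {H of GRing.Algebra K H & isHopf K H}.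

Section HopfInstances.
Variables (K : fieldType) (H : hopfAlgType K).

HB.instance Definition _ := GRing.isLinear.Build K H (tensor H H) *:%R
  (@comul K H) comul_is_linear.
HB.instance Definition _ := GRing.isMonoidMorphism.Build H (tensor H H)
  (@comul K H) comul_is_monoid_morphism.
HB.instance Definition _ := GRing.isLinear.Build K H K *%R
  (@counit K H) counit_is_scalar.
HB.instance Definition _ := GRing.isMonoidMorphism.Build H K
  (@counit K H) counit_is_monoid_morphism.
HB.instance Definition _ := GRing.isLinear.Build K H H *:%R
  (@antipode K H) antipode_is_linear.

End HopfInstances.

Section HopfProperties.
Variables (K : fieldType) (H : hopfAlgType K).

Definition involutory := forall x : H, antipode (antipode x) = x.

(* t lies in the image of C (x) D in U (x) V. *)
Definition in_tens (U V : lmodType K) (C : {pred U}) (D : {pred V}) (t : U ⊗ V) :=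
  exists2 s : seq (U * V), all (fun p => (p.1 \in C) && (p.2 \in D)) s &
    t = \sum_(p <- s) p.1 ⊗ p.2.

Definition hopf_subalgebra (C : {pred H}) :=
  [/\ GRing.subalg_closed C,
      forall x, x \in C -> in_tens C C (comul x) &
      forall x, x \in C -> antipode x \in C].

End HopfProperties.

Definition affine (K : fieldType) (A : algType K) :=
  exists s : seq A, forall B : {pred A},
    GRing.subalg_closed B -> {subset s <= B} -> forall x, x \in B.

Definition central (A : nzRingType) (C : {pred A}) :=
  forall c, c \in C -> forall x, c * x = x * c.

Definition fin_gen_over (A : nzRingType) (C : {pred A}) :=
  exists (n : nat) (g : 'I_n -> A), forall x : A,
    exists2 c : 'I_n -> A, (forall i, c i \in C) & x = \sum_i c i * g i.

(* A left A-module structure on the K-space V, compatible with its K-structure. *)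
Record module_on (K : fieldType) (A : algType K) (V : lmodType K) := ModuleOn {
  act :> A -> V -> V;
  act_bilinear : is_bilinear act;
  act1 : forall v, act 1 v = v;
  actM : forall a b v, act (a * b) v = act a (act b v)
}.

Section Modules.
Variables (K : fieldType) (A : algType K) (V : lmodType K) (M : module_on A V).

Definition submodule (P : {pred V}) :=
  GRing.submod_closed P /\ forall a v, v \in P -> M a v \in P.

Definition irreducible_submodule (P : {pred V}) :=
  [/\ submodule P,
      exists2 v, v \in P & v != 0 &
      forall Q : {pred V}, submodule Q -> {subset Q <= P} ->
        (forall v, v \in Q -> v = 0) \/ {subset P <= Q}].

Definition irreducible := irreducible_submodule predT.

(* V is the internal direct sum of a (possibly infinite) family of irreducible
   submodules. *)
Definition completely_reducible :=
  exists (I : eqType) (P : I -> {pred V}),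
    [/\ forall i, irreducible_submodule (P i),
        forall v, exists (s : seq I) (f : I -> V),
          (forall i, f i \in P i) /\ v = \sum_(i <- s) f i &
        forall (s : seq I) (f : I -> V), uniq s -> (forall i, f i \in P i) ->
          \sum_(i <- s) f i = 0 -> forall i, i \in s -> f i = 0].

End Modules.

Section TensorModule.
Variables (K : fieldType) (H : hopfAlgType K) (V W : lmodType K).
Variables (M : module_on H V) (N : module_on H W).

(* (a (x) b) (v (x) w) = a v (x) b w *)
Definition actT : H ⊗ H -> V ⊗ W -> V ⊗ W :=
  tlift2 (fun a b v w => M a v ⊗ N b w).

Definition tens_act (h : H) (t : V ⊗ W) : V ⊗ W := actT (comul h) t.

Let act12 v w : is_bilinear (fun a b => M a v ⊗ N b w).
Proof. by apply: tmap_bilinear; [apply: (act_bilinear M).1|apply: (act_bilinear N).1]. Qed.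

Let act34 a b : is_bilinear (fun v w => M a v ⊗ N b w).
Proof. by apply: tmap_bilinear; [apply: (act_bilinear M).2|apply: (act_bilinear N).2]. Qed.

Lemma actT_bilinear : is_bilinear actT.
Proof. exact: tlift2_bilinear act12 act34. Qed.

Lemma actTDl x y t : actT (x + y) t = actT x t + actT y t.
Proof. by have := actT_bilinear.1 t 1 x y; rewrite /= !scale1r. Qed.

Lemma actTDr x t u : actT x (t + u) = actT x t + actT x u.
Proof. by have := actT_bilinear.2 x 1 t u; rewrite /= !scale1r. Qed.

Lemma actT0l t : actT 0 t = 0.
Proof. by apply: (addrI (actT 0 t)); rewrite -actTDl !addr0. Qed.

Lemma actT0r x : actT x 0 = 0.
Proof. by apply: (addrI (actT x 0)); rewrite -actTDr !addr0. Qed.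

Lemma actT_tens a b v w : actT (a ⊗ b) (v ⊗ w) = M a v ⊗ N b w.
Proof. exact: tlift2_tens act12 act34 _ _ _ _. Qed.

Lemma tens_act_bilinear : is_bilinear tens_act.
Proof.
split=> [t a g h|h a t u] /=; rewrite /tens_act.
  by rewrite linearP; apply: actT_bilinear.1.
exact: actT_bilinear.2.
Qed.

Lemma tens_act1 t : tens_act 1 t = t.
Proof.
rewrite /tens_act rmorph1.
elim/tensor_ind: t => [|v w t IHt]; first exact: actT0r.
by rewrite actTDr IHt actT_tens !act1.
Qed.

Lemma tens_actM g h t : tens_act (g * h) t = tens_act g (tens_act h t).
Proof.
rewrite /tens_act rmorphM /=.
elim/tensor_ind: (comul g) => [|a b x IHx]; first by rewrite mul0r !actT0l.
rewrite mulrDl !actTDl IHx; congr (_ + _) => {x IHx}.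
elim/tensor_ind: (comul h) => [|c d y IHy].
  by rewrite mulr0 !actT0l actT0r.
rewrite mulrDr !actTDl actTDr IHy; congr (_ + _) => {y IHy}.
elim/tensor_ind: t => [|v w t IHt]; first by rewrite !actT0r.
by rewrite !actTDr IHt tensM !actT_tens !actM.
Qed.

Definition tens_module : module_on H (V ⊗ W)%type :=
  ModuleOn tens_act_bilinear tens_act1 tens_actM.

End TensorModule.

Definition chevalley_property (K : fieldType) (H : hopfAlgType K) :=
  forall (V W : vectType K) (M : module_on H V) (N : module_on H W),
    irreducible M -> irreducible N -> completely_reducible (tens_module M N).

(* Main.v *)
Require Import Defs.
From HB Require Import structures.
From mathcomp Require Import all_boot all_algebra.
From mathcomp Require Import boolp.
Import GRing.Theory VectorInternalTheory.
Local Open Scope ring_scope.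

Set Implicit Arguments.
Unset Strict Implicit.
Unset Printing Implicit Defensive.

(** The proof is an averaging argument, as in Maschke's theorem.

    Let [J] be the left ideal of [H] generated by the elements of [C] of counit
    zero.  The finitely many generators of [H] over [C] span [H] modulo [J],
    because [c - eps(c)] lies in [J] for [c] in [C]; so [H / J] is a
    finite-dimensional Hopf algebra.  It enters through the coordinate functionals
    [d_i] of a basis, which are functionals on [H] vanishing on [J], and through
    representatives [e_i] of that basis in [H] ([dual_basis_modulo]).

    The partial trace of the comultiplication of [H / J],
    [L = sum_i (e_i)_1 d_i((e_i)_2)], is an integral modulo [J], that is,
    [h L = eps(h) L] modulo [J]: write
    [h x_1 (x) x_2 = (h_1 x)_1 (x) S(h_2) (h_1 x)_2], which is where [S^2 = id]
    enters (it gives [S(h_2) h_1 = eps(h)]), and move the factor [S(h_2)] around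
    the trace, so that it meets [h_1] in [h_1 S(h_2) = eps(h)].  The counit of
    [L] is the trace of the identity of [H / J], its dimension, which is nonzero
    in characteristic zero ([integral_mod_aug_ideal]).  This replaces the theorem
    of Larson and Radford that an involutory finite-dimensional Hopf algebra in
    characteristic zero is semisimple.

    Now let [X] be a finite-dimensional [H]-module on which every element of [C]
    acts by a scalar.  On the endomorphisms of [X], with the adjoint action
    [h . p = h_1 p S(h_2)], the ideal [J] acts by zero ([adj_aug_ideal]), since
    for [c] in [C] the scalar [c_1] moves past [p].  Hence [L . p] commutes with
    [H] ([adj_equivariant]), and if [p] is a projection onto a submodule then
    [eps(L)^-1 (L . p)] is an [H]-linear one.  Every submodule of [X] therefore
    has a complement and [X] is completely reducible.

    If [V] and [W] are irreducible, then by Schur's lemma [C] acts on each of them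
    by scalars, and since [Delta(C)] lies in [C (x) C] it does so on [V (x) W],
    to which the previous paragraph applies. *)

(** * Linear maps and bilinear expressions *)

Lemma scaler_mull (R : pzRingType) (A : lalgType R) k (a b : A) :
  (k *: a) * b = k *: (a * b).
Proof. by rewrite scalerAl. Qed.

Lemma scaler_mulr (R : pzRingType) (A : algType R) k (a b : A) :
  a * (k *: b) = k *: (a * b).
Proof. by rewrite scalerAr. Qed.

(** Solves linearity goals in one or several variables for expressions built from
    products, scalings and maps with a canonical linear structure. *)
Ltac multilinear := repeat split; repeat intro; rewrite /= ?(linearD, linearZ, mulrDl,
  mulrDr, scaler_mull, scaler_mulr, scalerDr, scalerDl) /= ?scalerA //.

Lemma raw_linear0 (K : fieldType) (U W : lmodType K) (f : U -> W) : linear f -> f 0 = 0.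
Proof. by move=> fL; rewrite -[X in f X](scale0r 0) (scalable_linear fL) /= scale0r. Qed.

Lemma raw_linear_comb (K : fieldType) (U W : lmodType K) (f : U -> W) (I : Type)
    (r : seq I) (a : I -> K) (x : I -> U) : linear f ->
  f (\sum_(i <- r) a i *: x i) = \sum_(i <- r) a i *: f (x i).
Proof.
move=> fL; elim: r => [|i r IHr]; last by rewrite !big_cons fL IHr.
by rewrite !big_nil raw_linear0.
Qed.

Lemma raw_linear_sub (K : fieldType) (U W : lmodType K) (f : U -> W) u v : linear f ->
  f (u - v) = f u - f v.
Proof. by move=> fL; rewrite addrC -scaleN1r fL scaleN1r addrC. Qed.

Lemma scale_bilinear (K : fieldType) (U V W : lmodType K) (f : V -> K) (g : U -> W) :
  scalar f -> linear g -> is_bilinear (fun a b => f b *: g a).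
Proof.
move=> fL gL; split=> [b|a] k x y /=; first by rewrite gL scalerDr !scalerA mulrC.
by rewrite fL scalerDl scalerA.
Qed.

Lemma scalar_mull (K : fieldType) (A : algType K) (f : A -> K) v :
  scalar f -> scalar (fun b => f (v * b)).
Proof. by move=> fL k x y; rewrite mulrDr scaler_mulr fL. Qed.

Section TensorLift.
Variables (R : comNzRingType) (U V : lmodType R).

Lemma eq_tlift (W : lmodType R) (f g : U -> V -> W) t :
  (forall u v, f u v = g u v) -> tlift f t = tlift g t.
Proof. by move=> fg; apply: eq_bigr => p _; apply: fg. Qed.

Lemma linear_tlift (W W' : lmodType R) (g : W -> W') (f : U -> V -> W) t :
  linear g -> g (tlift f t) = tlift (fun u v => g (f u v)) t.
Proof.
move=> gL; pose h := HB.pack_for {linear W -> W'} g (GRing.isLinear.Build _ _ _ _ g gL).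
exact: (raddf_sum h).
Qed.

Lemma tlift_linearl (W W' : lmodType R) (f : W -> U -> V -> W') t :
  (forall u v, linear (fun w => f w u v)) -> linear (fun w => tlift (f w) t).
Proof.
move=> fL a w w'; rewrite /tlift scaler_sumr -big_split /=.
by apply: eq_bigr => p _; apply: fL.
Qed.

Lemma exchange_tlift (U' V' W : lmodType R) (f : U -> V -> U' -> V' -> W) s t :
  tlift (fun u v => tlift (fun u' v' => f u v u' v') t) s =
  tlift (fun u' v' => tlift (fun u v => f u v u' v') s) t.
Proof. exact: exchange_big. Qed.

End TensorLift.

Lemma tlift_in_tens (K : fieldType) (U V W : lmodType K) (D : {pred U}) (E : {pred V})
    (F G : U -> V -> W) t :
  is_bilinear F -> is_bilinear G -> in_tens D E t ->
  (forall u v, u \in D -> v \in E -> F u v = G u v) -> tlift F t = tlift G t.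
Proof.
move=> bF bG [s sDE ->] FG.
elim: s sDE => [_|p s IHs /= /andP [/andP [Dp Ep] sDE]].
  rewrite big_nil; transitivity (0 : W); [exact: tlift0|symmetry; exact: tlift0].
by rewrite big_cons !tlift_add // IHs // !tlift_tens // FG.
Qed.

(** * Sweedler calculus and the antipode *)

(** Sweedler's notation: [\sw_(a, b <- x) F a b] is the value on the coproduct of
    [x] of the linear map induced by the bilinear map [F]. *)
Reserved Notation "\sw_ ( a , b <- x ) F"
  (at level 41, F at level 41, a name, b name, x at level 60,
   format "'[' \sw_ ( a ,  b  <-  x ) '/  '  F ']'").
Notation "\sw_ ( a , b <- x ) F" := (tlift (fun a b => F) (comul x)) : ring_scope.

Section Sweedler.
Variables (K : fieldType) (H : hopfAlgType K).
Implicit Types (V W : lmodType K) (x y z : H).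

Definition trilinear W (F : H -> H -> H -> W) :=
  [/\ forall b c, linear (fun a => F a b c), forall a c, linear (fun b => F a b c)
    & forall a b, linear (F a b)].

Lemma swA W (F : H -> H -> H -> W) x : trilinear F ->
  \sw_(p, c <- x) \sw_(a, b <- p) F a b c =
  \sw_(a, p <- x) \sw_(b, c <- p) F a b c.
Proof.
move=> [F1 F2 F3].
have bF12 c : is_bilinear (fun a b => F a b c).
  by split=> [b|a] k u v; [apply: F1|apply: F2].
have bF23 a : is_bilinear (F a) by split=> [c|b] k u v; [apply: F2|apply: F3].
have bl : is_bilinear (fun (t : H ⊗ H) c => tlift (fun a b => F a b c) t).
  split=> [c|t k c c']; first exact: tlift_is_linear.
  by apply: (tlift_linearl (f := fun c a b => F a b c)) => a b; apply: F3.
have br : is_bilinear (fun a (t : H ⊗ H) => tlift (F a) t).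
  split=> [t k a a'|a]; last exact: tlift_is_linear.
  by apply: (tlift_linearl (f := F)) => b c; apply: F1.
pose G := tlift (fun a (t : H ⊗ H) => tlift (F a) t).
have GL : linear G by exact: tlift_is_linear.
have assocL : linear (@tassoc K H H H) by exact/tlift_is_linear/tassoc_bilinear.
transitivity (G (tassoc (tmap comul idfun (comul x)))); last first.
  rewrite comulA (linear_tlift _ _ GL).
  by apply: eq_tlift => a p; rewrite /G tlift_tens.
rewrite (linear_tlift _ _ assocL) (linear_tlift _ _ GL); apply: eq_tlift => p c.
apply: (eq_linear_tens (g := fun t : H ⊗ H => G (tassoc (t ⊗ c)))).
- exact: tlift_is_linear.
- by move=> k s t; rewrite tens_bilinear.1 assocL GL.
by move=> a b; rewrite tassoc_tens /G !tlift_tens.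
Qed.

Lemma swM W (F : H -> H -> W) x y : is_bilinear F ->
  \sw_(a, b <- x * y) F a b =
  \sw_(a, b <- x) \sw_(c, d <- y) F (a * c) (b * d).
Proof.
move=> bF; rewrite rmorphM /= [_ * _]/(tens_mul _ _) /tens_mul /tlift2.
rewrite linear_tlift; last exact: tlift_is_linear.
apply: eq_tlift => a b; rewrite linear_tlift; last exact: tlift_is_linear.
by apply: eq_tlift => c d; rewrite tlift_tens.
Qed.

Lemma sw1 W (F : H -> H -> W) : is_bilinear F -> \sw_(a, b <- 1) F a b = F 1 1.
Proof. by move=> bF; rewrite rmorph1 [1 in LHS]/(1 ⊗ 1) tlift_tens. Qed.

Lemma sw_linear W (F : H -> H -> W) : is_bilinear F ->
  linear (fun x => \sw_(a, b <- x) F a b).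
Proof. by move=> bF k x y; rewrite linearP; apply: tlift_is_linear. Qed.

(* The next four lemmas fold the types in the Hopf axioms, which otherwise block
   rewriting. *)
Lemma sw_counitl_id x : \sw_(a, b <- x) (counit a *: b) = x.
Proof. exact: comul_counitl. Qed.

Lemma sw_counitr_id x : \sw_(a, b <- x) (counit b *: a) = x.
Proof. exact: comul_counitr. Qed.

Lemma sw_antipodel x : \sw_(a, b <- x) (antipode a * b) = (counit x)%:A.
Proof. exact: antipodel. Qed.

Lemma sw_antipoder x : \sw_(a, b <- x) (a * antipode b) = (counit x)%:A.
Proof. exact: antipoder. Qed.

Lemma sw_counitl W (f : H -> W) x : linear f ->
  \sw_(a, b <- x) (counit a *: f b) = f x.
Proof.
move=> fL; rewrite -[in RHS](sw_counitl_id x) linear_tlift //.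
by apply: eq_tlift => a b; rewrite (scalable_linear fL).
Qed.

Lemma sw_counitr W (f : H -> W) x : linear f ->
  \sw_(a, b <- x) (counit b *: f a) = f x.
Proof.
move=> fL; rewrite -[in RHS](sw_counitr_id x) linear_tlift //.
by apply: eq_tlift => a b; rewrite (scalable_linear fL).
Qed.

Lemma antipode1 : antipode (1 : H) = 1.
Proof.
have := sw_antipodel (1 : H); rewrite sw1; last by multilinear.
by rewrite mulr1 rmorph1 scale1r.
Qed.

(** By coassociativity the last two factors [y_2 S(y_3)] cancel. *)
Let conv1 y a b :
  \sw_(y1, y2 <- y) \sw_(c, d <- y1) (antipode (a * c) * (b * d) * antipode y2) =
  antipode (a * y) * b.
Proof.
rewrite (swA (F := fun c d e => antipode (a * c) * (b * d) * antipode e)); last by multilinear.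
rewrite -(sw_counitr (f := fun c => antipode (a * c) * b)); last by multilinear.
apply: eq_tlift => c p.
rewrite -[RHS]mulr_algr -sw_antipoder linear_tlift; last by multilinear.
by apply: eq_tlift => d e; rewrite !mulrA.
Qed.

(** Both sides are [S(z_1 y_1) z_2 y_2 S(y_3)]: the first by cancelling [y_2 S(y_3)],
    the second because [S(z_1 y_1) z_2 y_2] is the antipode axiom for [z y]. *)
Let conv2 y z :
  \sw_(a, b <- z) (antipode (a * y) * b) = counit z *: antipode y.
Proof.
transitivity (\sw_(a, b <- z) \sw_(y1, y2 <- y) \sw_(c, d <- y1)
    (antipode (a * c) * (b * d) * antipode y2)).
  by apply: eq_tlift => a b; rewrite conv1.
rewrite exchange_tlift.
rewrite -(sw_counitl (f := fun y => counit z *: antipode y)); last first.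
  by multilinear; rewrite mulrC.
apply: eq_tlift => y1 y2; rewrite scalerA mulrC -rmorphM -[RHS]mulr_algl -sw_antipodel.
rewrite swM; last by multilinear.
rewrite (linear_tlift (g := fun u => u * antipode y2)); last by multilinear.
apply: eq_tlift => a b.
by rewrite (linear_tlift (g := fun u => u * antipode y2)); last by multilinear.
Qed.

(** The antipode is the convolution inverse of the identity, and both sides are
    convolution inverses of the multiplication map; concretely, they are equal to
    [S(x_1 y) x_2 S(x_3)]. *)
Lemma antipodeM x y : antipode (x * y) = antipode y * antipode x.
Proof.
rewrite -(sw_counitl (f := fun z => antipode y * antipode z)); last by multilinear.
transitivity (\sw_(z, c <- x) \sw_(a, b <- z) (antipode (a * y) * b * antipode c)).
  rewrite swA; last by multilinear.
  rewrite -(sw_counitr (f := fun a => antipode (a * y))); last by multilinear.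
  apply: eq_tlift => a p; rewrite -[LHS]mulr_algr -sw_antipoder linear_tlift; last by multilinear.
  by apply: eq_tlift => b c; rewrite mulrA.
apply: eq_tlift => z c; rewrite scalerAl -conv2 (linear_tlift (g := fun u => u * antipode c)) //.
by multilinear.
Qed.

(** Apply [S] to [S(x_1) x_2 = eps(x)]. *)
Lemma sw_antipode_flip x : involutory H ->
  \sw_(a, b <- x) (antipode b * a) = (counit x)%:A.
Proof.
move=> invH; rewrite -[LHS]invH (linear_tlift (g := @antipode K H)); last by multilinear.
rewrite (eq_tlift (g := fun a b : H => antipode a * b)); last first.
  by move=> a b; rewrite antipodeM invH.
by rewrite sw_antipodel linearZ /= antipode1.
Qed.

End Sweedler.

(** * Coordinates modulo a subspace of finite codimension *)

Section BasisModulo.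
Variables (K : fieldType) (V : lmodType K) (J : V -> Prop).
Hypotheses (J0 : J 0) (JP : forall k u v, J u -> J v -> J (k *: u + v)).

Definition spans_modulo n (g : 'I_n -> V) :=
  forall x, exists a : 'I_n -> K, J (x - \sum_i a i *: g i).

(** A spanning family of least size is linearly independent modulo [J], and the
    coordinates with respect to it are the functionals [d i]. *)
Lemma dual_basis_modulo n (g : 'I_n -> V) : spans_modulo g ->
  exists m (e : 'I_m -> V) (d : 'I_m -> V -> K),
    [/\ forall i, scalar (d i), forall i x, J x -> d i x = 0,
        forall x, J (x - \sum_i d i x *: e i) & forall i, d i (e i) = 1].
Proof.
pose P m := `[< exists g : 'I_m -> V, spans_modulo g >].
move=> gS; have exP : exists m, P m by exists n; apply/asboolP; exists g.
case: (ex_minnP exP) => {n g gS exP} m /asboolP [e eS] min_m.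
have JD u v : J u -> J v -> J (u + v) by move=> Ju Jv; rewrite -[u]scale1r; apply: JP.
have JZ k u : J u -> J (k *: u) by move=> Ju; rewrite -[_ *: u]addr0; apply: JP.
have JB u v : J u -> J v -> J (u - v) by move=> Ju Jv; rewrite -scaleN1r addrC; apply: JP.
have free (a : 'I_m -> K) : J (\sum_i a i *: e i) -> forall i, a i = 0.
  case: m e eS min_m a => [|m] e eS min_m a Ja k; first by case: k.
  apply/eqP/negPn/negP => ak0.
  have /min_m : P m; last by rewrite ltnn.
  (* The relation [a] lets [e k] be eliminated from any combination [b]. *)
  apply/asboolP; exists (fun i => e (lift k i)) => x.
  have [b Jb] := eS x; pose t := b k / a k.
  exists (fun i => b (lift k i) - t * a (lift k i)).
  have -> : \sum_i (b (lift k i) - t * a (lift k i)) *: e (lift k i) =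
            \sum_i (b i - t * a i) *: e i.
    by rewrite (bigD1_ord k) //= /t divfK // subrr scale0r add0r.
  suff -> : x - \sum_i (b i - t * a i) *: e i =
            t *: (\sum_i a i *: e i) + (x - \sum_i b i *: e i) by apply: JP.
  rewrite scaler_sumr addrCA -sumrB; congr (_ + _); rewrite -sumrN.
  by apply: eq_bigr => i _; rewrite scalerBl scalerA opprB.
have [c cE] := choice eS; exists m, e, (fun i x => c x i).
have uniq_c x (b : 'I_m -> K) : J (x - \sum_i b i *: e i) -> forall i, c x i = b i.
  move=> Jb i; apply/eqP; rewrite -subr_eq0; apply/eqP.
  apply: (free (fun i => c x i - b i)).
  rewrite (eq_bigr (fun i => c x i *: e i - b i *: e i)); last by move=> *; rewrite scalerBl.
  rewrite sumrB -(subrK x (\sum_i c x i *: e i)) -addrA -opprB addrC; exact: JB.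
split=> [i k x y|i x Jx|x|i]; first 1 last.
- apply: (uniq_c x (fun=> 0)); rewrite big1 ?subr0 // => j _; exact: scale0r.
- exact: cE.
- rewrite (uniq_c _ (fun j => (j == i)%:R)) ?eqxx //.
  rewrite (bigD1 i) //= eqxx scale1r big1 ?addr0 ?subrr // => j /negPf ->.
  exact: scale0r.
apply: (uniq_c _ (fun i => k * c x i + c y i)).
rewrite (_ : _ - _ = k *: (x - \sum_i c x i *: e i) + (y - \sum_i c y i *: e i)).
  exact: JP.
rewrite scalerBr scaler_sumr addrACA -opprD -big_split /=; congr (_ - _).
by apply: eq_bigr => j _; rewrite scalerDl scalerA.
Qed.

End BasisModulo.

(** * The ideal generated by the augmentation ideal of [C] *)

Section AugmentationIdeal.
Variables (K : fieldType) (H : hopfAlgType K) (C : {pred H}).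
Implicit Types x y z : H.

(** The left ideal [H C^+], where [C^+] is the kernel of the counit on [C]. *)
Inductive aug_ideal : H -> Prop :=
| aug_ideal0 : aug_ideal 0
| aug_idealD g c z : c \in C -> counit c = 0 -> aug_ideal z -> aug_ideal (g * c + z).

Lemma aug_ideal_add x y : aug_ideal x -> aug_ideal y -> aug_ideal (x + y).
Proof.
move=> Jx Jy; elim: Jx => [|g c z Cc c0 _ IH]; first by rewrite add0r.
by rewrite -addrA; apply: aug_idealD.
Qed.

Lemma aug_ideal_mull h x : aug_ideal x -> aug_ideal (h * x).
Proof.
elim=> [|g c z Cc c0 _ IH]; first by rewrite mulr0; apply: aug_ideal0.
by rewrite mulrDr mulrA; apply: aug_idealD.
Qed.

Lemma aug_ideal_scale k x : aug_ideal x -> aug_ideal (k *: x).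
Proof. by move=> Jx; rewrite -mulr_algl; apply: aug_ideal_mull. Qed.

Lemma aug_idealP k x y : aug_ideal x -> aug_ideal y -> aug_ideal (k *: x + y).
Proof. by move=> Jx; apply/aug_ideal_add/aug_ideal_scale. Qed.

Lemma aug_ideal_counit x : aug_ideal x -> counit x = 0.
Proof.
by elim=> [|g c z _ c0 _ IH]; rewrite ?linear0 // linearD rmorphM /= c0 IH mulr0 addr0.
Qed.

Lemma aug_ideal_sum I (r : seq I) (F : I -> H) :
  (forall i, aug_ideal (F i)) -> aug_ideal (\sum_(i <- r) F i).
Proof. by move=> JF; apply: big_ind => //; [apply: aug_ideal0|apply: aug_ideal_add]. Qed.

Lemma aug_ideal_tlift (U V : lmodType K) (F : U -> V -> H) t :
  (forall a b, aug_ideal (F a b)) -> aug_ideal (tlift F t).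
Proof. by move=> JF; apply: aug_ideal_sum. Qed.

Hypothesis hopfC : hopf_subalgebra C.

Lemma aug_ideal_sub g c : c \in C -> aug_ideal (g * c - counit c *: g).
Proof.
case: hopfC => [[C1 CL _] _ _] Cc.
rewrite -(mulr_algr _ g) -mulrBr -[_ * _]addr0; apply: aug_idealD; last exact: aug_ideal0.
  by rewrite addrC -scaleNr; apply: CL.
by rewrite linearB linearZ /= rmorph1 mulr1 subrr.
Qed.

Hypotheses (centralC : central C) (fgHC : fin_gen_over C).

Lemma fin_gen_spans : exists n (g : 'I_n -> H), spans_modulo aug_ideal g.
Proof.
case: fgHC => n [g gE]; exists n, g => x; case: (gE x) => c Cc ->.
exists (fun i => counit (c i)); rewrite -sumrB; apply: aug_ideal_sum => i.
by rewrite centralC //; apply: aug_ideal_sub.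
Qed.

End AugmentationIdeal.

(** * An integral with nonzero counit *)

Section Slice.
Variables (K : fieldType) (H : hopfAlgType K) (f : H -> K).
Hypothesis fL : scalar f.

Definition slice (x : H) : H := \sw_(a, b <- x) (f b *: a).

Lemma slice_bilinear u v : is_bilinear (fun a b : H => f (v * b) *: (u * a)).
Proof. by apply: scale_bilinear; [apply: scalar_mull|multilinear]. Qed.

Lemma slice_linear : linear slice.
Proof. by apply: sw_linear; apply: (scale_bilinear (g := id)). Qed.

Lemma counit_slice x : counit (slice x) = f x.
Proof.
(* [K^o] is [K] as a module over itself, so that scalar-valued maps are linear maps. *)
transitivity (\sw_(a, b <- x) (f b * counit a : K^o)).
  rewrite (linear_tlift (W' := K^o) (g := counit)); last by move=> k u v; rewrite linearP.
  by apply: eq_bigr => p _; rewrite linearZ.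
rewrite -[in RHS](sw_counitl_id x) (linear_tlift (W' := K^o) (g := f)); last exact: fL.
by apply: eq_bigr => p _; rewrite (scalable_linear fL) /= mulrC.
Qed.

(** [J] is a coideal: for [c] in [C^+], the functional [f] only sees the counit of
    the second factor of [Delta(c)], so [g c] is sliced to
    [f(g_2) g_1 c]. *)
Lemma slice_aug_ideal (C : {pred H}) x : hopf_subalgebra C ->
  (forall y, aug_ideal C y -> f y = 0) -> aug_ideal C x -> aug_ideal C (slice x).
Proof.
move=> hopfC fJ; elim=> [|g c {}x Cc c0 Jx IHx].
  by rewrite (raw_linear0 slice_linear); apply: aug_ideal0.
rewrite -[g * c]scale1r slice_linear scale1r; apply: aug_ideal_add => //.
rewrite /slice swM; last by apply: (scale_bilinear (g := id)).
apply: aug_ideal_tlift => u v.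
have -> : \sw_(a, b <- c) (f (v * b) *: (u * a)) = f v *: (u * c).
  have uL : linear (fun a : H => f v *: (u * a)) by multilinear; rewrite mulrC.
  rewrite -(sw_counitr c uL).
  case: (hopfC) => _ /(_ c Cc) Cc2 _; apply: tlift_in_tens Cc2 _.
  - exact: slice_bilinear.
  - by apply: scale_bilinear uL => k y z; apply: linearP.
  move=> a b _ Cb; rewrite scalerA; congr (_ *: _).
  have /fJ := aug_ideal_sub hopfC v Cb.
  by rewrite addrC -scaleNr fL => /eqP; rewrite mulNr addrC subr_eq0 => /eqP ->.
by rewrite -scaler_mull -[_ * _]addr0; apply: aug_idealD; last exact: aug_ideal0.
Qed.

(** [h x_1 (x) x_2 = h_1 x_1 (x) S(h_3) h_2 x_2 = (h_1 x)_1 (x) S(h_2) (h_1 x)_2];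
    the first step is [sw_antipode_flip]. *)
Lemma mul_slice h x : involutory H ->
  h * slice x = \sw_(u, v <- h) \sw_(a, b <- u * x) (f (antipode v * b) *: a).
Proof.
move=> invH; transitivity (\sw_(a, b <- x) \sw_(u, v <- h) \sw_(u1, u2 <- u)
    (f (antipode v * (u2 * b)) *: (u1 * a))); last first.
  rewrite exchange_tlift; apply: eq_tlift => u v; rewrite exchange_tlift swM //.
  by apply: (scale_bilinear (g := id)) => //; apply: scalar_mull.
rewrite (linear_tlift (g := fun y => h * y)); last by multilinear.
apply: eq_tlift => a b; rewrite swA; last first.
  split=> [u2 v|u1 v|u1 u2] k y z.
  - by rewrite mulrDl scaler_mull scalerDr !scalerA mulrC.
  - by rewrite mulrDl mulrDr scaler_mull scaler_mulr fL scalerDl scalerA.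
  - by rewrite linearP mulrDl scaler_mull fL scalerDl scalerA.
have -> : h * (f b *: a) = \sw_(u, v <- h) (counit v *: (f b *: (u * a))).
  rewrite (sw_counitr (f := fun u => f b *: (u * a))) ?scaler_mulr //.
  by multilinear; rewrite mulrC.
apply: eq_tlift => u v.
rewrite (eq_tlift (g := fun u2 v2 => f (antipode v2 * u2 * b) *: (u * a))); last first.
  by move=> u2 v2; rewrite mulrA.
have gL : linear (fun w => f (w * b) *: (u * a)).
  by move=> k y z; rewrite mulrDl scaler_mull fL scalerDl scalerA.
rewrite -(linear_tlift (g := fun w => f (w * b) *: (u * a))) //.
by rewrite sw_antipode_flip // mulr_algl (scalable_linear fL) scalerA.
Qed.

End Slice.

Section Integral.
Variables (K : fieldType) (H : hopfAlgType K) (C : {pred H}).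
Hypotheses (charK0 : [pchar K] =i pred0) (hopfC : hopf_subalgebra C).
Hypotheses (centralC : central C) (fgHC : fin_gen_over C) (invH : involutory H).

Let J := aug_ideal C.

(** The partial trace of the comultiplication of [H / J], in the basis [e] with
    coordinates [d]. *)
Lemma integral_mod_aug_ideal : exists L : H,
  counit L != 0 /\ forall h, J (h * L - counit h *: L).
Proof.
have [n0 [g0 gS]] := fin_gen_spans hopfC centralC fgHC.
have [n [e [d [dL dJ dE de]]]] :=
  dual_basis_modulo (aug_ideal0 C) (@aug_idealP _ _ C) gS.
pose F i := slice (d i).
have FL i : linear (F i) by exact: slice_linear.
have FJ i x : J x -> J (F i x) by apply: slice_aug_ideal hopfC (dJ i).
exists (\sum_i F i (e i)); split.
  rewrite linear_sum /= (eq_bigr (fun=> 1)); last by move=> i _; rewrite counit_slice // de.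
  rewrite sumr_const card_ord; move/pcharf0P: charK0 => ->.
  (* [H / J] is not zero, because the counit vanishes on [J]. *)
  apply/eqP=> n0E; move: dE; rewrite {}n0E in e d dL dJ de F FL FJ * => /(_ 1).
  rewrite big_ord0 subr0 => /aug_ideal_counit; rewrite rmorph1 => /eqP.
  by rewrite oner_eq0.
move=> h.
have d_coords (f : H -> K) b : scalar f -> (forall x, J x -> f x = 0) ->
    f b = \sum_j f (e j) * d j b.
  move=> fL fJ; rewrite -[b in LHS](subrK (\sum_j d j b *: e j)).
  rewrite -[b - _]scale1r fL mul1r fJ // add0r.
  rewrite (raw_linear_comb (W := K^o) _ _ _ fL).
  by apply: eq_bigr => j _; rewrite mulrC.
(* The matrix [d i (S(v) e j)] of multiplication by [S(v)] on [H / J] is split off. *)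
have mulF i x : h * F i x =
  \sum_j \sw_(u, v <- h) (d i (antipode v * e j) *: F j (u * x)).
  rewrite mul_slice // /tlift exchange_big; apply: eq_bigr => -[u v] _ /=.
  under [RHS]eq_bigr do rewrite /F /slice /tlift scaler_sumr.
  rewrite exchange_big; apply: eq_bigr => -[a b] _ /=.
  rewrite (d_coords _ b (scalar_mull _ (dL i)) (fun y Jy => dJ i _ (aug_ideal_mull _ Jy))).
  by rewrite scaler_suml; apply: eq_bigr => j _; rewrite scalerA.
rewrite mulr_sumr (eq_bigr _ (fun i _ => mulF i (e i))) exchange_big /= scaler_sumr -sumrB.
apply: aug_ideal_sum => j.
have -> : counit h *: F j (e j) = \sw_(u, v <- h) F j (u * (antipode v * e j)).
  have gL : linear (fun w => F j (w * e j)).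
    by move=> k x y; rewrite mulrDl scaler_mull FL.
  rewrite -(scalable_linear (FL j)) -mulr_algl -sw_antipoder (linear_tlift _ _ gL).
  by apply: eq_tlift => u v; rewrite mulrA.
(* Summed over [i], the same matrix reassembles [S(v) e j], now to the right of [u]. *)
rewrite /tlift exchange_big -sumrB; apply: aug_ideal_sum => -[u v] /=.
rewrite (_ : _ - _ = - 1 *: F j (u * (antipode v * e j - \sum_i d i (antipode v * e j) *: e i))).
  by apply: aug_ideal_scale; apply: FJ; apply: aug_ideal_mull.
rewrite scaleN1r mulrBr mulr_sumr; under [in RHS]eq_bigr do rewrite scaler_mulr.
by rewrite (raw_linear_sub _ _ (FL j)) opprB (raw_linear_comb _ _ _ (FL j)).
Qed.

End Integral.

(** * Complete reducibility from complements *)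

(** A subspace of largest dimension contained in [P] is all of [P]. *)
Lemma submod_closed_vspace (K : fieldType) (V : vectType K) (P : {pred V}) :
  GRing.submod_closed P -> exists U : {vspace V}, P =i U.
Proof.
move=> [P0 PL]; pose inP (d : nat) := `[< exists2 U : {vspace V}, {subset U <= P} & \dim U = d >].
have ex_d : exists d, inP d.
  exists 0%N; apply/asboolP; exists 0%VS; last exact: dimv0.
  by move=> v; rewrite memv0 => /eqP ->.
have le_d d : inP d -> (d <= \dim {:V})%N.
  by move=> /asboolP [U _ <-]; apply: dimvS; apply: subvf.
case: (ex_maxnP ex_d le_d) => d /asboolP [U UP dU] max_d.
exists U => v; apply/idP/idP => [Pv|]; last exact: UP.
have UvP : {subset U + <[v]> <= P}%VS.
  move=> _ /memv_addP [u Uu [_ /vlineP [k ->] ->]].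
  by rewrite addrC; apply: PL => //; apply: UP.
have le_dim : (\dim (U + <[v]>) <= \dim U)%N.
  by rewrite dU; apply: max_d; apply/asboolP; exists (U + <[v]>)%VS.
have /eqP -> : U == (U + <[v]>)%VS by rewrite eqEdim addvSl.
by apply: (subvP (addvSr U <[v]>)); apply: memv_line.
Qed.

Section SemisimpleModule.
Variables (K : fieldType) (A : algType K) (V : vectType K) (M : module_on A V).
Implicit Types U W : {vspace V}.

Definition stable U := forall a v, v \in U -> M a v \in U.

Lemma stable_submodule U : stable U -> submodule M (fun v => v \in U).
Proof.
by move=> sU; split=> //; split=> [|k u v Uu Uv]; rewrite unfold_in ?mem0v ?memvD ?memvZ.
Qed.

Lemma stableI U W : stable U -> stable W -> stable (U :&: W)%VS.
Proof. by move=> sU sW a v /memv_capP [Uv Wv]; apply/memv_capP; split; auto. Qed.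

Lemma submodule_vspace (P : {pred V}) :
  submodule M P -> exists2 U, stable U & P =i U.
Proof.
case=> /submod_closed_vspace [U PU] PM; exists U => // a v.
by rewrite -!PU; apply: PM.
Qed.

(** A nonzero submodule of least dimension is irreducible. *)
Lemma irreducible_in U : stable U -> U != 0%VS ->
  exists W, [/\ stable W, (W <= U)%VS, W != 0%VS
              & irreducible_submodule M (fun v => v \in W)].
Proof.
move=> sU U0.
pose Q d := `[< exists W, [/\ stable W, (W <= U)%VS, W != 0%VS & \dim W = d] >].
have exQ : exists d, Q d by exists (\dim U); apply/asboolP; exists U; rewrite subvv.
case: (ex_minnP exQ) => d /asboolP [W [sW WU W0 dW]] min_d.
exists W; split=> //; split; first exact: stable_submodule.
  by exists (vpick W); [exact: memv_pick|rewrite vpick0].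
move=> R /submodule_vspace [R' sR' RR'] RW.
have R'W : (R' <= W)%VS by apply/subvP => v; rewrite -RR' => /RW.
have [R'0|R'0] := eqVneq R' 0%VS; [left|right] => v.
  by rewrite RR' R'0 memv0 => /eqP.
rewrite unfold_in RR' => Wv.
have le_d : (d <= \dim R')%N.
  by apply: min_d; apply/asboolP; exists R'; split=> //; apply: subv_trans WU.
have /eqP -> // : R' == W by rewrite eqEdim R'W dW.
Qed.

Hypothesis stable_compl : forall U, stable U ->
  exists U', [/\ stable U', (U + U' = fullv)%VS & (U :&: U' = 0)%VS].

(** Induction on the dimension: split off an irreducible submodule [W] of [U]; a
    complement of [W] meets [U] in a complement of [W] inside [U], by the modular
    law.  The equality of dimensions expresses that the sum is direct. *)
Lemma irreducible_decomposition U : stable U ->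
  exists k (P : 'I_k -> {vspace V}),
    [/\ forall i, irreducible_submodule M (fun v => v \in P i),
        (\sum_i P i)%VS = U & \dim U = (\sum_i \dim (P i))%N].
Proof.
have [n] := ubnP (\dim U); elim: n => // n IHn in U *; rewrite ltnS => le_Un sU.
have [->|U0] := eqVneq U 0%VS.
  by exists 0%N, (fun=> 0%VS); split=> [[]||] //; rewrite ?big_ord0 ?dimv0.
have [W [sW WU W0 irrW]] := irreducible_in sU U0.
have [W' [sW' WW' WI]] := stable_compl sW.
have UE : (W + (W' :&: U) = U)%VS by rewrite vspace_modl // WW' capfv.
have dI : (W :&: (W' :&: U) = 0)%VS by rewrite capvA WI cap0v.
have dU : \dim U = (\dim W + \dim (W' :&: U))%N by rewrite -{1}UE dimv_disjoint_sum.
have lt_n : (\dim (W' :&: U) < n)%N.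
  apply: leq_trans le_Un; rewrite dU -[X in (X < _)%N]add0n ltn_add2r.
  by rewrite lt0n dimv_eq0.
have [k [P [irrP PE dP]]] := IHn _ lt_n (stableI sW' sU).
exists k.+1, (fun i => oapp P W (unlift ord0 i)); split=> [i||].
- by case: (unlift ord0 i).
- rewrite big_ord_recl unlift_none /= (eq_bigr P) ?PE // => i _.
  by rewrite liftK.
- rewrite dU big_ord_recl unlift_none /= dP; congr (_ + _)%N.
  by apply: eq_bigr => i _; rewrite liftK.
Qed.

Lemma completely_reducible_of_compl : completely_reducible M.
Proof.
have [|k [P [irrP PE dP]]] := @irreducible_decomposition fullv.
  by move=> a v _; apply: memvf.
exists 'I_k, (fun i v => v \in P i); split=> // [v|s f s_uniq fP s0 i si].
  have : v \in (\sum_i P i)%VS by rewrite PE memvf.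
  case/memv_sumP => f fP ->; exists (index_enum 'I_k), f; split=> // i.
  by rewrite unfold_in fP.
have dxP : directv (\sum_i P i) by rewrite directvE /= PE dP.
have := directv_sum_independent dxP (fun i => if i \in s then f i else 0).
move=> /(_ _ _ i isT); rewrite si; apply=> [j _|].
  by case: ifP => _; rewrite ?mem0v //; apply: fP.
by rewrite -big_mkcond -big_uniq.
Qed.

End SemisimpleModule.

(** * Averaging over the adjoint action *)

Section Averaging.
Variables (K : fieldType) (H : hopfAlgType K) (C : {pred H}).
Variables (V : lmodType K) (M : module_on H V).
Hypotheses (hopfC : hopf_subalgebra C)
  (scalC : forall c, c \in C -> exists k, forall v, M c v = k *: v).

Lemma act_linear a : linear (M a).
Proof. exact: (act_bilinear M).2. Qed.

Lemma act_linearl v : linear (M^~ v).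
Proof. exact: (act_bilinear M).1. Qed.

Lemma act_scalar k v : M k%:A v = k *: v.
Proof. by rewrite (scalable_linear (act_linearl v)) /= act1. Qed.

(** The adjoint action [h_1 p S(h_2)] of [h] on an endomorphism [p], evaluated at [v]. *)
Definition adj (p : V -> V) h v := \sw_(a, b <- h) M a (p (M (antipode b) v)).

Section Linear.
Variables (p : V -> V) (pL : linear p).

Let adj_bilinear v : is_bilinear (fun a b => M a (p (M (antipode b) v))).
Proof.
split=> [b|a] k x y /=; first exact: act_linearl.
by rewrite linearP act_linearl pL act_linear.
Qed.

Lemma adj_linear h : linear (adj p h).
Proof.
apply: (tlift_linearl (f := fun v a b => M a (p (M (antipode b) v)))) => a b k u v.
by rewrite act_linear pL act_linear.
Qed.

Lemma adj_linearl v : linear (fun h => adj p h v).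
Proof. exact: sw_linear. Qed.

Lemma adjM g h v : adj p (g * h) v =
  \sw_(a, b <- g) M a (adj p h (M (antipode b) v)).
Proof.
rewrite /adj swM //; apply: eq_tlift => a b.
rewrite linear_tlift; last exact: act_linear.
by apply: eq_tlift => c d; rewrite antipodeM !actM.
Qed.

(** The factor [c_1] acts by a scalar, so it moves past [p] and meets [S(c_2)]. *)
Lemma adj_central c v : c \in C -> adj p c v = counit c *: p v.
Proof.
move=> Cc; case: hopfC => _ /(_ c Cc) Cc2 _.
have gL : linear (fun h => p (M h v)) by move=> k x y; rewrite act_linearl pL.
transitivity (\sw_(a, b <- c) p (M (a * antipode b) v)).
  apply: (tlift_in_tens _ _ Cc2) => //.
    split=> [b|a] k x y /=; rewrite ?linearP ?mulrDl ?mulrDr ?scaler_mull ?scaler_mulr;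
      by rewrite act_linearl pL.
  move=> a b Ca _; have [k kE] := scalC Ca.
  by rewrite actM !kE (scalable_linear pL).
rewrite -(linear_tlift (g := fun h => p (M h v))) // sw_antipoder act_scalar.
exact: (scalable_linear pL).
Qed.

Lemma adj_aug_ideal h v : aug_ideal C h -> adj p h v = 0.
Proof.
elim=> [|g c z Cc c0 _ IH].
  exact: raw_linear0 (adj_linearl v).
rewrite -[g * c]scale1r adj_linearl IH scale1r addr0 adjM /tlift big1 // => -[a b] _ /=.
by rewrite adj_central // c0 scale0r (raw_linear0 (act_linear a)).
Qed.

(** [h (L . p) = h_1 (L . p) S(h_2) h_3 = (h_1 . (L . p)) h_2 = (L . p) h]. *)
Lemma adj_equivariant L : (forall h, aug_ideal C (h * L - counit h *: L)) ->
  forall h v, M h (adj p L v) = adj p L (M h v).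
Proof.
move=> LJ h v.
have adjhL g u : adj p (g * L) u = counit g *: adj p L u.
  have := adj_aug_ideal u (LJ g); rewrite (raw_linear_sub _ _ (adj_linearl u)).
  by move=> /eqP; rewrite subr_eq0 (scalable_linear (adj_linearl u)) => /eqP.
have -> : adj p L (M h v) = \sw_(g, c <- h) adj p (g * L) (M c v).
  rewrite -(sw_counitl (f := fun c => adj p L (M c v))) //.
    by apply: eq_tlift => g c; rewrite adjhL.
  by move=> k x y; rewrite act_linearl adj_linear.
have -> : M h (adj p L v) =
    \sw_(a, q <- h) \sw_(b, c <- q) M a (adj p L (M (antipode b * c) v)).
  rewrite -(sw_counitr (f := fun a => M a (adj p L v))); last exact: act_linearl.
  apply: eq_tlift => a q.
  have gL : linear (fun w => M a (adj p L (M w v))).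
    by move=> k x y; rewrite act_linearl adj_linear act_linear.
  rewrite -(linear_tlift _ _ gL) sw_antipodel act_scalar.
  by rewrite (scalable_linear (adj_linear L)) (scalable_linear (act_linear a)).
rewrite -swA; last first.
  split=> [b c|a c|a b] k x y; first by rewrite act_linearl.
    by rewrite linearP mulrDl scaler_mull act_linearl adj_linear act_linear.
  by rewrite mulrDr scaler_mulr act_linearl adj_linear act_linear.
apply: eq_tlift => q c; rewrite adjM; apply: eq_tlift => a b.
by rewrite actM.
Qed.

End Linear.
End Averaging.

(** The average of a projection onto a submodule is an equivariant projection onto
    it, whose kernel is a complement. *)
Lemma completely_reducible_central_scalar (K : fieldType) (H : hopfAlgType K)
    (C : {pred H}) (L : H) (V : vectType K) (M : module_on H V) :
  hopf_subalgebra C -> (forall c, c \in C -> exists k, forall v, M c v = k *: v) ->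
  counit L != 0 -> (forall h, aug_ideal C (h * L - counit h *: L)) ->
  completely_reducible M.
Proof.
move=> hopfC scalC L0 LJ; apply: completely_reducible_of_compl => U sU.
pose p v := (counit L)^-1 *: projv U v.
have pL : linear p by move=> k u v; rewrite /p linearP scalerDr !scalerA mulrC.
have qL := adj_linear M pL L.
pose q : {linear V -> V} := HB.pack_for {linear V -> V} (adj M p L)
  (GRing.isLinear.Build _ _ _ _ (adj M p L) qL).
have qU v : linfun q v \in U.
  rewrite lfunE /= /adj; apply: memv_suml => ab _; apply: sU.
  by rewrite memvZ // memv_proj.
have q_id u : u \in U -> linfun q u = u.
  move=> Uu; rewrite lfunE /= /adj.
  rewrite (eq_tlift (g := fun a b => (counit L)^-1 *: M (a * antipode b) u)).
    rewrite -(linear_tlift (g := fun w => (counit L)^-1 *: M w u)).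
      by rewrite sw_antipoder act_scalar scalerA mulVf ?scale1r.
    by move=> k x y; rewrite act_linearl scalerDr !scalerA mulrC.
  move=> a b; rewrite /p projv_id; last exact: sU.
  by rewrite (scalable_linear (act_linear M a)) actM.
exists (lker (linfun q)); split.
- move=> a v; rewrite !memv_ker !lfunE /= => /eqP qv0.
  rewrite -(adj_equivariant hopfC scalC pL LJ) qv0.
  by rewrite (raw_linear0 (act_linear M a)).
- apply: subv_anti; rewrite subvf; apply/subvP => v _.
  rewrite -[v](subrK (linfun q v)) addrC; apply: memv_add => //.
  by rewrite memv_ker linearB /= [linfun q (linfun q v)]q_id // subrr.
- apply/eqP; rewrite -subv0; apply/subvP => v /memv_capP [Uv].
  by rewrite memv_ker memv0 q_id.
Qed.

(** * Tensor products of irreducible modules *)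

Section TensorVector.
Variables (K : fieldType) (V W : vectType K).

(** In coordinates, [v ⊗ w] is the matrix of the products of the coordinates. *)
Let outer (v : V) (w : W) : 'M[K]_(dim V, dim W) := (v2r v)^T *m v2r w.

Let outer_bilinear : is_bilinear outer.
Proof.
split=> [w|v] k x y; rewrite /outer /= !(linearD, linearZ) //=.
by rewrite mulmxDl scalemxAl.
Qed.

Definition tens_coords (t : V ⊗ W) : 'rV[K]_(dim V * dim W) := mxvec (tlift outer t).

Definition tens_of_coords (r : 'rV[K]_(dim V * dim W)) : V ⊗ W :=
  \sum_i \sum_j vec_mx r i j *: (r2v (delta_mx 0 i) ⊗ r2v (delta_mx 0 j)).

Lemma tens_coords_linear : linear tens_coords.
Proof.
by move=> k s t; rewrite /tens_coords (tlift_is_linear outer_bilinear) linearP.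
Qed.

Lemma tens_of_coords_linear : linear tens_of_coords.
Proof.
move=> k r s; rewrite /tens_of_coords scaler_sumr -big_split; apply: eq_bigr => i _ /=.
rewrite scaler_sumr -big_split; apply: eq_bigr => j _ /=.
by rewrite linearP !mxE scalerDl scalerA.
Qed.

Lemma vect_coords (U : vectType K) (u : U) : u = \sum_i v2r u 0 i *: r2v (delta_mx 0 i).
Proof.
rewrite -{1}[u]v2rK {1}[v2r u]row_sum_delta linear_sum.
by apply: eq_bigr => i _; rewrite linearZ.
Qed.

Lemma tens_coordsK : cancel tens_coords tens_of_coords.
Proof.
apply: eq_linear_tens => [k s t|//|v w].
  by rewrite tens_coords_linear tens_of_coords_linear.
rewrite /tens_of_coords /tens_coords tlift_tens // mxvecK.
rewrite [in RHS](vect_coords v) (raw_linear_comb _ _ _ (tens_bilinear.1 w)).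
apply: eq_bigr => i _; rewrite [in RHS](vect_coords w).
rewrite (raw_linear_comb _ _ _ (tens_bilinear.2 _)) scaler_sumr.
by apply: eq_bigr => j _; rewrite scalerA mxE big_ord1 !mxE.
Qed.

Lemma tens_of_coordsK : cancel tens_of_coords tens_coords.
Proof.
move=> r; rewrite /tens_of_coords -[RHS]vec_mxK [in RHS](matrix_sum_delta (vec_mx r)).
pose f := HB.pack_for {linear (V ⊗ W)%type -> 'rV[K]_(dim V * dim W)} tens_coords
  (GRing.isLinear.Build _ _ _ _ _ tens_coords_linear).
rewrite [LHS](linear_sum f) linear_sum; apply: eq_bigr => i _.
rewrite [LHS](raw_linear_comb _ _ _ tens_coords_linear) linear_sum; apply: eq_bigr => j _.
rewrite linearZ; congr (_ *: _).
rewrite /= /tens_coords tlift_tens // /outer !r2vK trmx_delta.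
by rewrite mul_delta_mx.
Qed.

Lemma tens_vector_axiom : Vector.axiom (dim V * dim W) (V ⊗ W)%type.
Proof.
exists tens_coords; first exact: tens_coords_linear.
by exists tens_of_coords; [apply: tens_coordsK|apply: tens_of_coordsK].
Qed.

HB.instance Definition _ := Lmodule_hasFinDim.Build K (tensor V W) tens_vector_axiom.

End TensorVector.

(** Schur's lemma: an eigenspace of [c] is a nonzero submodule. *)
Lemma central_act_scalar (K : closedFieldType) (A : algType K) (V : vectType K)
    (M : module_on A V) c : irreducible M -> (forall x, c * x = x * c) ->
  exists k, forall v, M c v = k *: v.
Proof.
move=> [_ [v0 _ v00] irr] cC.
have cL : linear (M c) by exact: (act_bilinear M).2.
pose f : 'rV[K]_(dim V) -> 'rV[K]_(dim V) := fun r => v2r (M c (r2v r)).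
have fL : linear f by move=> k r s; rewrite /f linearP cL linearP.
pose f' := HB.pack_for {linear 'rV[K]_(dim V) -> 'rV[K]_(dim V)} f
  (GRing.isLinear.Build _ _ _ _ f fL).
have dV : dim V != 0%N.
  apply: contra v00 => /eqP d0; rewrite -[v0]v2rK; apply/eqP.
  suff -> : v2r v0 = 0 by rewrite linear0.
  by apply/rowP => i; have := ltn_ord i; rewrite {2}d0.
have [k] : exists k, root (char_poly (lin1_mx f')) k.
  by apply/closed_rootP; rewrite size_char_poly eqSS.
rewrite -eigenvalue_root_char => /eigenvalueP [r rk r0]; rewrite mul_rV_lin1 /= in rk.
exists k; pose Q : {pred V} := fun v => M c v == k *: v.
have Qsub : submodule M Q.
  split; last first.
    move=> a v /eqP cv; apply/eqP.
    by rewrite -actM cC actM cv (scalable_linear ((act_bilinear M).2 a)).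
  split=> [|b u v /eqP cu /eqP cv]; apply/eqP.
    by rewrite (raw_linear0 cL) scaler0.
  by rewrite cL cu cv scalerDr !scalerA mulrC.
case: (irr Q Qsub) => [//|Q0 v|QV v]; last exact/eqP/QV.
have /Q0 /(congr1 v2r) : r2v r \in Q.
  by apply/eqP; apply: (can_inj v2rK); rewrite linearZ /= r2vK.
by rewrite r2vK linear0 => rE; rewrite rE eqxx in r0.
Qed.

(** The coproduct of [c] is a sum of tensors [a ⊗ b] with [a] and [b] in [C], and
    each of these acts by a scalar. *)
Lemma tens_act_scalar (K : fieldType) (H : hopfAlgType K) (C : {pred H})
    (V W : lmodType K) (M : module_on H V) (N : module_on H W) c :
  hopf_subalgebra C -> (forall c, c \in C -> exists k, forall v, M c v = k *: v) ->
  (forall c, c \in C -> exists k, forall w, N c w = k *: w) ->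
  c \in C -> exists k, forall t, tens_module M N c t = k *: t.
Proof.
move=> [_ Cc2 _] Msc Nsc /Cc2 [s sC cE].
suff [k kE] : exists k, forall t, actT M N (\sum_(p <- s) p.1 ⊗ p.2) t = k *: t.
  by exists k => t; rewrite -kE -cE.
elim: s sC {cE} => [_|p s IHs /= /andP [/andP [Cp1 Cp2] /IHs [k kE]]].
  by exists 0 => t; rewrite big_nil actT0l scale0r.
have [a aE] := Msc _ Cp1; have [b bE] := Nsc _ Cp2.
exists (a * b + k) => t; rewrite big_cons actTDl kE scalerDl; congr (_ + _).
elim/tensor_ind: t => [|v w t IHt]; first by rewrite actT0r scaler0.
rewrite actTDr IHt actT_tens aE bE scalerDr; congr (_ + _).
rewrite (scalable_linear (tens_bilinear.1 _)) /= (scalable_linear (tens_bilinear.2 _)) /=.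
by rewrite scalerA.
Qed.

Theorem corollary3p3 (K : closedFieldType) (charK0 : [pchar K] =i pred0)
  (H : hopfAlgType K) (affineH : affine H)
  (C : {pred H}) (hopfC : hopf_subalgebra C) (centralC : central C)
  (fgHC : fin_gen_over C) (invH : involutory H) :
  chevalley_property H.
Proof.
move=> V W M N irrM irrN.
have [L [L0 LJ]] := integral_mod_aug_ideal charK0 hopfC centralC fgHC invH.
apply: (@completely_reducible_central_scalar K H C L (tensor V W)) => // c Cc.
apply: (tens_act_scalar hopfC) Cc => {}c Cc;
  by apply: central_act_scalar => //; apply: centralC.
Qed.
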